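(* Let $\Lambda_\infty(\alpha)$ be a power series space of infinite type. The Rhaly operator $R_\theta:\Lambda_\infty(\alpha)\to\Lambda_\infty(\alpha)$ is m-topologizable for every $\theta\in\Lambda_\infty(\alpha)$.
   Context: $\mathbb{N}=\{1,2,\dots\}$, $\mathbb{N}_0=\{0,1,2,\dots\}$. $\alpha=(\alpha_n)_{n\in\mathbb{N}}$ is a non-negative increasing sequence tending to $\infty$, and $\Lambda_\infty(\alpha)=\{x=(x_n)_{n\in\mathbb{N}}:\|x\|_k:=\sum_{n=1}^\infty|x_n|e^{k\alpha_n}<\infty\ \text{for all }k\in\mathbb{N}\}$, a Fréchet space with the seminorms $\|\cdot\|_k$. $e_n$ is the sequence with $1$ in the $n$-th place and $0$ elsewhere. A sequence $\theta=(\theta_n)_{n\in\mathbb{N}_0}$ is viewed as an element of a sequence space indexed by $\mathbb{N}$ by taking $\theta_{n-1}$ as its $n$-th coordinate. The Rhaly operator $R_\theta$ is defined by $R_\theta e_n=\sum_{j=n}^\infty \theta_{j-1}e_j$ and $R_\theta x=\sum_{n=1}^\infty x_nR_\theta e_n=\sum_{n=1}^\infty\big(\sum_{j=1}^n x_j\big)\theta_{n-1}e_n$. A continuous linear operator $T$ on a Fréchet space $E$ with seminorms $(\|\cdot\|_p)_{p\in\mathbb{N}}$ is m-topologizable if for every $p\in\mathbb{N}$ there exist $q\in\mathbb{N}$ and $C_p\ge1$ such that $\|T^kx\|_p\le C_p^k\|x\|_q$ for all $k\in\mathbb{N}$ and $x\in E$. *)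

(* Defs.v *)
From HB Require Import structures.
From mathcomp Require Import all_boot all_order all_algebra.
From mathcomp Require Import all_classical all_reals all_analysis.
From mathcomp Require Import complex.
Set Implicit Arguments.
Unset Strict Implicit.
Unset Printing Implicit Defensive.
Import Order.TTheory GRing.Theory Num.Theory.
Import numFieldNormedType.Exports.
Local Open Scope classical_set_scope.
Local Open Scope ring_scope.

(* Real-valued absolute values, so that real and complex sequence spaces can
   be treated at once: the norm of MathComp on R[i] takes its values in R[i]. *)
Record absval (R : realType) (K : numFieldType) := AbsVal {
  absv :> K -> R;
  absv_ge0 : forall x, 0 <= absv x;
  absv_eq0 : forall x, (absv x == 0) = (x == 0);
  absvM : forall x y, absv (x * y) = absv x * absv y;
  ler_absvD : forall x y, absv (x + y) <= absv x + absv y }.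

Definition real_absval (R : realType) : absval R R :=
  @AbsVal R R Num.norm (@normr_ge0 R R) (@normr_eq0 R R) (@normrM R)
    (@ler_normD R R).

Section complex_absval.
Context (R : realType).

Let normc_ge0 (z : R[i]) : 0 <= Normc.normc z.
Proof. by case: z => x y; rewrite sqrtr_ge0. Qed.

Let normc_eq0 (z : R[i]) : (Normc.normc z == 0) = (z == 0).
Proof.
by apply/eqP/eqP => [/Normc.eq0_normc|->]//; rewrite Normc.normc0.
Qed.

Definition complex_absval : absval R R[i] :=
  @AbsVal R R[i] (@Normc.normc R) normc_ge0 normc_eq0
    (@Normc.normcM R) (@le_normcD R).

End complex_absval.

Section absval_theory.
Context {R : realType} {K : numFieldType} (a : absval R K).

Lemma absv0 : a 0 = 0.
Proof. by apply/eqP; rewrite absv_eq0. Qed.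

Lemma absv1 : a 1 = 1.
Proof.
have a1 : a 1 != 0 by rewrite absv_eq0 oner_eq0.
by apply: (mulfI a1); rewrite -absvM !mulr1.
Qed.

Lemma absvN x : a (- x) = a x.
Proof.
have aN1 : a (-1) = 1.
  apply/eqP; rewrite -(@pexpr_eq1 _ _ 2) ?absv_ge0//.
  by rewrite expr2 -absvM mulrNN mulr1 absv1.
by rewrite -mulN1r absvM aN1 mul1r.
Qed.

Lemma ler_absv_sum (x : nat -> K) n :
  a (\sum_(i < n) x i) <= \sum_(i < n) a (x i).
Proof.
elim: n => [|n IH]; first by rewrite !big_ord0 absv0.
by rewrite !big_ord_recr/= (le_trans (ler_absvD _ _ _))// lerD2r.
Qed.

End absval_theory.

(* Sequences indexed by {1, 2, ...} are represented by functions on nat: the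
   n-th coordinate of x is [x n.-1]. With this shift the sequence
   (theta_n)_{n >= 0}, seen in a space of sequences indexed from 1, is [theta]
   itself. *)

Record exponent_sequence (R : realType) := ExponentSequence {
  expo :> nat -> R;
  expo_ge0 : forall n, 0 <= expo n;
  expo_nondecreasing : nondecreasing_seq expo;
  expo_cvg : expo @ \oo --> +oo }.

Section power_series_space.
Context {R : realType} {K : numFieldType} (a : absval R K)
  (alpha : exponent_sequence R).

Definition weighted (k : nat) (x : nat -> K^o) : R^nat :=
  fun n => a (x n) * expR (k%:R * alpha n).

Definition power_series_summable : {pred (nat -> K^o)} :=
  fun x => `[< forall k, (0 < k)%N -> cvgn (series (weighted k x)) >].

Lemma weighted_ge0 k (x : nat -> K^o) n : 0 <= weighted k x n.
Proof. by rewrite mulr_ge0 ?absv_ge0 ?expR_ge0. Qed.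

Lemma weightedD_le k (x y : nat -> K^o) n :
  weighted k (x + y) n <= (weighted k x + weighted k y) n.
Proof. by rewrite /weighted /= -mulrDl ler_wpM2r ?expR_ge0 ?ler_absvD. Qed.

Lemma weightedZ k c (x : nat -> K^o) :
  weighted k (c *: x) = a c *: weighted k x.
Proof. by apply/funext => n; rewrite /weighted /= absvM -mulrA. Qed.

Lemma weighted0 k : weighted k 0 = 0.
Proof. by apply/funext => n; rewrite /weighted /= absv0 mul0r. Qed.

Lemma power_series_summableP x : reflect
  (forall k, (0 < k)%N -> cvgn (series (weighted k x)))
  (x \in power_series_summable).
Proof. exact: asboolP. Qed.

Lemma power_series_summable_closed : subsemimod_closed power_series_summable.
Proof.
split; first split.
- apply/power_series_summableP => k k0; rewrite weighted0.
  rewrite (_ : series 0 = cst 0); first exact: is_cvg_cst.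
  by apply/funext => n; rewrite /series /= big1.
- move=> x y /power_series_summableP xS /power_series_summableP yS.
  apply/power_series_summableP => k k0.
  apply: (series_le_cvg _ _ (@weightedD_le k x y)).
  + by move=> n; exact: weighted_ge0.
  + by move=> n; rewrite addr_ge0 ?weighted_ge0.
  + exact: is_cvg_seriesD (xS _ k0) (yS _ k0).
- move=> c x /power_series_summableP xS.
  apply/power_series_summableP => k k0; rewrite weightedZ.
  exact: is_cvg_seriesZ (xS _ k0).
Qed.

HB.instance Definition _ := GRing.isSubmodClosed.Build K (nat -> K^o)
  power_series_summable power_series_summable_closed.

Record Lambda_infty := LambdaInfty {
  Lambda_val :> nat -> K^o;
  LambdaP : Lambda_val \in power_series_summable }.

HB.instance Definition _ := [isSub for Lambda_val].
HB.instance Definition _ := [Choice of Lambda_infty by <:].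
HB.instance Definition _ := [SubChoice_isSubLmodule of Lambda_infty by <:].

Definition Lambda_norm (k : nat) (x : Lambda_infty) : R :=
  limn (series (weighted k x)).

Lemma Lambda_summable (x : Lambda_infty) k :
  (0 < k)%N -> cvgn (series (weighted k x)).
Proof. by move: k; apply/power_series_summableP; exact: LambdaP. Qed.

Lemma Lambda_norm0 k : Lambda_norm k 0 = 0.
Proof.
rewrite /Lambda_norm weighted0 (_ : series 0 = cst 0) ?lim_cst//.
by apply/funext => n; rewrite /series /= big1.
Qed.

Lemma Lambda_normD k (x y : Lambda_infty) : (0 < k)%N ->
  Lambda_norm k (x + y) <= Lambda_norm k x + Lambda_norm k y.
Proof.
move=> k0; rewrite /Lambda_norm -lim_seriesD; last 2 first.
- exact: Lambda_summable.
- exact: Lambda_summable.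
apply: lim_series_le => [||n].
- exact: Lambda_summable.
- by apply: is_cvg_seriesD; exact: Lambda_summable.
- exact: weightedD_le.
Qed.

(* The topology generated by the norms of index k >= 1. *)
Definition Lambda_nbhs (x : Lambda_infty) : set_system Lambda_infty :=
  [set U | exists n : nat, exists2 e : R, 0 < e &
    [set y | forall k, (0 < k <= n)%N -> Lambda_norm k (y - x) < e] `<=` U].

HB.instance Definition _ := hasNbhs.Build Lambda_infty Lambda_nbhs.

Let Lambda_nbhs_singleton (x : Lambda_infty) (U : set Lambda_infty) : nbhs x U -> U x.
Proof.
by move=> [n [e e0]]; apply => k _ /=; rewrite subrr Lambda_norm0.
Qed.

Let Lambda_nbhs_filter (x : Lambda_infty) : ProperFilter (nbhs x).
Proof.
split=> [/Lambda_nbhs_singleton//|]; split.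
- by exists 0%N, 1.
- move=> U V [n [e e0 nU]] [m [d d0 mV]].
  exists (maxn n m), (Num.min e d); first by rewrite lt_min e0.
  move=> y /= yx; split; [apply: nU|apply: mV] => k /= /andP[k0 kn].
  + have := yx k; rewrite k0 leq_max kn => /(_ isT).
    by rewrite lt_min => /andP[].
  + have := yx k; rewrite k0 leq_max kn orbT => /(_ isT).
    by rewrite lt_min => /andP[].
- by move=> U V UV [n [e e0 nU]]; exists n, e => //; exact: subset_trans UV.
Qed.

Let Lambda_nbhs_nbhs (x : Lambda_infty) (U : set Lambda_infty) :
  nbhs x U -> nbhs x (nbhs^~ U).
Proof.
move=> [n [e e0 nU]]; exists n, (e / 2); first by rewrite divr_gt0.
move=> y /= yx; exists n, (e / 2); first by rewrite divr_gt0.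
move=> z /= zy; apply: nU => k /= kn.
have -> : z - x = (z - y) + (y - x) by rewrite addrA subrK.
have /andP[k0 _] := kn.
by rewrite (le_lt_trans (Lambda_normD _ _ k0))// [e]splitr ltrD ?zy ?yx.
Qed.

HB.instance Definition _ := Nbhs_isNbhsTopological.Build Lambda_infty
  Lambda_nbhs_filter Lambda_nbhs_singleton Lambda_nbhs_nbhs.

Section rhaly.
Variable theta : Lambda_infty.

Definition rhaly_seq (x : nat -> K^o) : nat -> K^o :=
  fun n => (\sum_(j < n.+1) x j) * theta n.

Lemma rhaly_seq_unit (n : nat) :
  rhaly_seq (fun j => (j == n)%:R) = fun j => if (n <= j)%N then theta j else 0.
Proof.
apply/funext => j; rewrite /rhaly_seq.
case: leqP => nj; last first.
  rewrite big1 ?mul0r// => i _.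
  by rewrite (ltn_eqF (leq_ltn_trans (ltn_ord i : (i <= j)%N) nj)).
rewrite (bigD1 (Ordinal (nj : (n < j.+1)%N)))//= eqxx big1 ?addr0 ?mul1r//.
by move=> i; rewrite -val_eqE /= => /negbTE ->.
Qed.

Lemma sum_absv_le (x : Lambda_infty) n :
  \sum_(j < n) a (x j) <= Lambda_norm 1 x.
Proof.
apply: (@le_trans _ _ (series (weighted 1 x) n)); last first.
  apply: nondecreasing_cvgn_le; last exact: Lambda_summable.
  by apply: nondecreasing_series => i _ _; exact: weighted_ge0.
rewrite /series /= big_mkord; apply: ler_sum => j _.
rewrite /weighted mul1r ler_peMr ?absv_ge0//.
by rewrite -expR0 ler_expR expo_ge0.
Qed.

Lemma rhaly_subproof (x : Lambda_infty) :
  rhaly_seq x \in power_series_summable.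
Proof.
apply/power_series_summableP => k k0.
have h n : weighted k (rhaly_seq x) n <=
    (Lambda_norm 1 x *: weighted k theta) n.
  rewrite /weighted absvM -mulrA ler_wpM2r ?mulr_ge0 ?absv_ge0 ?expR_ge0//.
  exact: le_trans (ler_absv_sum _ _ _) (sum_absv_le _ _).
apply: (series_le_cvg _ _ h) => [n|n|].
- exact: weighted_ge0.
- exact: le_trans (weighted_ge0 _ _ _) (h n).
- by apply: is_cvg_seriesZ; exact: Lambda_summable.
Qed.

Definition rhaly (x : Lambda_infty) : Lambda_infty :=
  LambdaInfty (rhaly_subproof x).

Let rhaly_linear : linear rhaly.
Proof.
move=> c x y; apply/val_inj/funext => n /=.
rewrite /rhaly_seq big_split/= mulrDl; congr (_ + _).
by rewrite -mulr_sumr -mulrA.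
Qed.

HB.instance Definition _ := GRing.isLinear.Build K Lambda_infty Lambda_infty
  *:%R rhaly rhaly_linear.

End rhaly.

End power_series_space.

Definition m_topologizable (R : realType) (K : numFieldType)
    (E : PreTopologicalLmodule.type K) (T : {linear E -> E})
    (seminorm : nat -> E -> R) : Prop :=
  continuous T /\
  forall p, (0 < p)%N ->
    exists q : nat, exists C : R,
      [/\ (0 < q)%N, 1 <= C &
          forall (k : nat) (x : E), (0 < k)%N ->
            seminorm p (iter k T x) <= C ^+ k * seminorm q x].

(* Main.v *)
Require Import Defs.
From HB Require Import structures.
From mathcomp Require Import all_boot all_order all_algebra.
From mathcomp Require Import all_classical all_reals all_analysis.
From mathcomp Require Import complex.
Local Open Scope ring_scope.
Import Order.TTheory GRing.Theory Num.Theory.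
Import numFieldNormedType.Exports.

(* Partial sums of [x] are bounded by [‖x‖_1], so [‖R_θ x‖_k ≤ ‖θ‖_k ‖x‖_1];
   iterating, [‖R_θ^k x‖_p ≤ ‖θ‖_p ‖θ‖_1^(k-1) ‖x‖_1], so q = 1 works for every
   p. *)

(** All weights are at least 1 because [alpha] is nonnegative, so [sum_absv_le] bounds every partial
    sum of [x] by its norm of index 1. Hence one application of the operator trades a norm of any
    index for that of index 1 ([Lambda_norm_rhaly]), which gives continuity. Under iteration the
    index then stays at 1, so the growth is geometric with ratio [Lambda_norm 1 theta]
    ([Lambda_norm_iter_rhaly]). *)

Section rhaly_bounds.
Context {R : realType} {K : numFieldType} {a : absval R K}
  {alpha : exponent_sequence R}.
Implicit Types theta x : Lambda_infty a alpha.

Lemma Lambda_norm_ge0 k x : (0 < k)%N -> 0 <= Lambda_norm k x.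
Proof.
move=> k0; apply: limr_ge; first exact: Lambda_summable.
by apply: nearW => n; apply: sumr_ge0 => i _; exact: weighted_ge0.
Qed.

Lemma Lambda_norm_rhaly k theta x : (0 < k)%N ->
  Lambda_norm k (rhaly theta x) <= Lambda_norm k theta * Lambda_norm 1 x.
Proof.
move=> k0.
(* Writing the product as the sum of a scaled series reduces the bound to a termwise comparison. *)
have -> : Lambda_norm k theta * Lambda_norm 1 x =
    limn (series (Lambda_norm 1 x *: weighted a alpha k theta)).
  have := lim_seriesZ (Lambda_norm 1 x) (@Lambda_summable _ _ _ _ theta _ k0).
  by move=> ->; rewrite mulrC.
apply: lim_series_le => [||n].
- exact: Lambda_summable.
- by apply: is_cvg_seriesZ; exact: Lambda_summable.
- rewrite /weighted absvM -mulrA ler_wpM2r ?mulr_ge0 ?absv_ge0 ?expR_ge0//.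
  exact: le_trans (ler_absv_sum _ _ _) (sum_absv_le _ _).
Qed.

(** Only the outermost application sees the index [k]; the induction hypothesis is used at index 1,
    hence the generalization over [k]. *)
Lemma Lambda_norm_iter_rhaly k n theta x : (0 < k)%N ->
  Lambda_norm k (iter n.+1 (rhaly theta) x) <=
    Lambda_norm k theta * Lambda_norm 1 theta ^+ n * Lambda_norm 1 x.
Proof.
elim: n k => [|n IH] k k0; first by rewrite mulr1; exact: Lambda_norm_rhaly.
rewrite iterS (le_trans (Lambda_norm_rhaly _ _ _ k0))// -mulrA.
by rewrite ler_wpM2l ?Lambda_norm_ge0// exprS IH.
Qed.

Lemma rhaly_continuous theta : continuous (rhaly theta).
Proof.
move=> x U [n [e e0 nU]].
(* [C] dominates the norms of [theta] of all indices from 1 to [n] at once; the summand 1 makes it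
   positive, so that [e / C] is a valid radius. *)
pose C := 1 + \sum_(i < n) Lambda_norm i.+1 theta.
have C0 : 0 < C by rewrite ltr_pwDl// sumr_ge0// => i _; exact: Lambda_norm_ge0.
exists 1%N, (e / C); first by rewrite divr_gt0.
move=> y /= yx; apply: nU => -[//|k] /= kn; rewrite -linearB.
apply: le_lt_trans (Lambda_norm_rhaly _ _ _ (ltn0Sn k)) _.
have kC : Lambda_norm k.+1 theta <= C.
  rewrite /C (bigD1 (Ordinal kn))//= addrCA lerDl addr_ge0// sumr_ge0// => i _.
  exact: Lambda_norm_ge0.
apply: (@le_lt_trans _ _ (C * Lambda_norm 1 (y - x))).
  by rewrite ler_wpM2r ?Lambda_norm_ge0.
by rewrite mulrC -ltr_pdivlMr// yx.
Qed.

Lemma rhaly_m_topologizable theta :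
  m_topologizable (rhaly theta) (@Lambda_norm R K a alpha).
Proof.
split=> [|p p0]; first exact: rhaly_continuous.
(* [C] absorbs both kinds of factor in the iterated bound: one of index [p] and the others of index
   1. *)
pose C := 1 + (Lambda_norm 1 theta + Lambda_norm p theta).
have t1 : 0 <= Lambda_norm 1 theta by exact: Lambda_norm_ge0.
have tp : 0 <= Lambda_norm p theta by exact: Lambda_norm_ge0.
have C1 : 1 <= C by rewrite lerDl addr_ge0.
have t1C : Lambda_norm 1 theta <= C by rewrite /C addrCA lerDl addr_ge0.
have tpC : Lambda_norm p theta <= C by rewrite /C addrA lerDr addr_ge0.
exists 1%N, C; split=> // -[//|k] x _.
apply: le_trans (Lambda_norm_iter_rhaly _ _ _ _ p0) _.
rewrite ler_wpM2r ?Lambda_norm_ge0// exprS ler_pM ?exprn_ge0//.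
by rewrite lerXn2r ?nnegrE// (le_trans t1).
Qed.

End rhaly_bounds.

(* Scalars: both the real and the complex space. *)
Theorem corollary5p2 (R : realType) (alpha : exponent_sequence R) :
  (forall theta : Lambda_infty (real_absval R) alpha,
     m_topologizable (rhaly theta) (@Lambda_norm R R (real_absval R) alpha)) /\
  (forall theta : Lambda_infty (complex_absval R) alpha,
     m_topologizable (rhaly theta)
       (@Lambda_norm R R[i] (complex_absval R) alpha)).
Proof. by split=> theta; exact: rhaly_m_topologizable. Qed.
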